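(* Let $k$ be a field of characteristic $p>0$, let $d_1,\ldots,d_n$ be positive integers, let $A = k[x_1,\ldots,x_n]/(x_1^{d_1}, \ldots, x_n^{d_n})$ and $t = \sum_{i = 1}^n (d_i-1)$. If $m\ge 0$ is an integer with $\max(p,d_1, \ldots, d_n)>(t+m)/2$, then for each $i\ge 0$ the map $A_i \to A_{i+m}$ given by $f \mapsto f \cdot (x_1 + \dots + x_n)^m$ has maximal rank.
   Context: $A$ is graded by degree, $A=\bigoplus_{i\ge 0}A_i$, with $A_i$ the image of the homogeneous polynomials of degree $i$. A linear map has maximal rank if it is injective or surjective. *)

(* Defs.v *)
From HB Require Import structures.
From mathcomp Require Import all_boot all_order all_algebra.
From mathcomp Require Import mpoly.
Set Implicit Arguments. Unset Strict Implicit. Unset Printing Implicit Defensive.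
Import Order.TTheory GRing.Theory.
Local Open Scope ring_scope.

Definition in_mon_ideal (k : fieldType) (n : nat) (d : 'I_n -> nat)
  (f : {mpoly k[n]}) : Prop :=
  exists q : 'I_n -> {mpoly k[n]}, f = \sum_(j < n) q j * 'X_j ^+ d j.

Definition sum_vars (k : fieldType) (n : nat) : {mpoly k[n]} := \sum_(j < n) 'X_j.

(* A = k[x]/I, A_i = image of the homogeneous polynomials of degree i.
   The map A_i -> A_{i+m}, [f] |-> [f * l^m] (l = x_1+...+x_n) is well defined.
   Injectivity: for homogeneous f of degree i, f*l^m in I implies f in I. *)
Definition mult_map_injective (k : fieldType) (n : nat) (d : 'I_n -> nat)
  (i m : nat) : Prop :=
  forall f : {mpoly k[n]}, f \is i.-homog ->
    in_mon_ideal (k:=k) d (f * sum_vars k n ^+ m) -> in_mon_ideal (k:=k) d f.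

Definition mult_map_surjective (k : fieldType) (n : nat) (d : 'I_n -> nat)
  (i m : nat) : Prop :=
  forall g : {mpoly k[n]}, g \is (i + m)%N.-homog ->
    exists2 f : {mpoly k[n]}, f \is i.-homog &
      in_mon_ideal (k:=k) d (g - f * sum_vars k n ^+ m).

Definition mult_map_max_rank (k : fieldType) (n : nat) (d : 'I_n -> nat)
  (i m : nat) : Prop :=
  mult_map_injective k d i m \/ mult_map_surjective k d i m.

(* Main.v *)
Require Import Defs.
From HB Require Import structures.
From mathcomp Require Import all_boot all_order all_algebra.
From mathcomp Require Import mpoly zify ring.
Set Implicit Arguments. Unset Strict Implicit. Unset Printing Implicit Defensive.
Import Order.TTheory GRing.Theory.
Local Open Scope ring_scope.

(** Monomial duality on A, whose socle has degree t, makes the maps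
    A_i -> A_(i+m) and A_(t-i-m) -> A_(t-i) transpose to each other, so it is
    enough to prove injectivity when 2i + m <= t; then i + m < max(p, d_j).
    If i + m < d_j, look at the highest power of x_j occurring in f.
    If i + m < p, induct on t.  When 2i + m < t, replacing each d_j > 1 in turn
    by d_j - 1 leaves only the socle monomial in f.  When 2i + m = t, the sl_2
    lowering operator F with [F, l] = t - 2 deg turns l^m f = 0 into
    l^m F f + m l^(m-1) f = 0; multiplying by l kills F f by the case
    2(i-1) + (m+1) < t, and then l^(m-1) f = 0 kills f. *)

(** * The monomial ideal and its reduced monomials *)

Section Ideal.
Variables (k : fieldType) (n : nat).
Implicit Types (f g q : {mpoly k[n]}) (a b : 'X_{1..n}) (d : 'I_n -> nat).

Definition below d a := [forall j, a j < d j]%N.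

Lemma belowP d a : reflect (forall j, a j < d j)%N (below d a).
Proof. exact: forallP. Qed.

Lemma mcoeff_mulXm q a b :
  (q * 'X_[a])@_b = if (a <= b)%MM then q@_(b - a) else 0.
Proof.
case: ifP => [le_ab|/negbT nle_ab].
  by rewrite -{1}(submK le_ab) addmC mcoeffMX.
apply: memN_msupp_eq0; apply: contra nle_ab => /msuppM_le.
case/allpairsP=> -[c e] /= [_]; rewrite msuppX inE => /eqP -> ->.
exact: lem_addl.
Qed.

Lemma mcoeff_mulX q j b :
  (q * 'X_j)@_b = if b j != 0%N then q@_(b - U_(j)) else 0.
Proof. by rewrite mcoeff_mulXm lep1mP. Qed.

Lemma mcoeffM_sum f q b :
  (f * q)@_b = \sum_(a <- msupp f | (a <= b)%MM) f@_a * q@_(b - a).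
Proof.
rewrite {1}[f]mpolyE mulr_suml raddf_sum /= [RHS]big_mkcond /=.
apply: eq_bigr => a _; rewrite -scalerAl mcoeffZ mulrC ['X_[a] * _]mulrC.
by rewrite mcoeff_mulXm; case: ifP; rewrite ?mul0r // mulrC.
Qed.

Lemma in_mon_ideal_add d f g :
  in_mon_ideal d f -> in_mon_ideal d g -> in_mon_ideal d (f + g).
Proof.
move=> [u ->] [v ->]; exists (fun j => u j + v j).
by rewrite -big_split; apply: eq_bigr => j _; rewrite mulrDl.
Qed.

Lemma in_mon_ideal0 d : in_mon_ideal d (0 : {mpoly k[n]}).
Proof. by exists (fun=> 0); rewrite big1 // => j _; rewrite mul0r. Qed.

(** A monomial that is not [below] d is divisible by some x_j^(d_j), so it lies in the ideal on its
    own. Every later membership question becomes one about coefficients. *)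
Lemma in_mon_idealP d f :
  in_mon_ideal d f <-> (forall a, below d a -> f@_a = 0).
Proof.
split=> [[q ->] a /belowP a_d|f0].
  rewrite raddf_sum big1 //= => j _; rewrite mpolyXn mcoeff_mulXm ifF //.
  apply/negbTE/negP => /mnm_lepP/(_ j); rewrite leqNgt => /negP[].
  by rewrite mulmnE mnm1E eqxx mul1n.
rewrite [f]mpolyE; apply: (big_ind (in_mon_ideal d)) => [||a _].
- exact: in_mon_ideal0.
- exact: in_mon_ideal_add.
have [/f0->|/forallPn[j]] := boolP (below d a).
  by rewrite scale0r; apply: in_mon_ideal0.
rewrite -leqNgt => d_a.
exists (fun i => if i == j then f@_a *: 'X_[a - U_(j) *+ d j] else 0).
rewrite (bigD1 j) //= eqxx big1 ?addr0 => [|i /negbTE->]; last by rewrite mul0r.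
rewrite mpolyXn -scalerAl -mpolyXD submK //.
apply/mnm_lepP=> i; rewrite mulmnE mnm1E.
by case: eqP => [<-|_]; rewrite ?mul1n ?mul0n.
Qed.

Lemma in_mon_ideal_mull d f g : in_mon_ideal d f -> in_mon_ideal d (f * g).
Proof.
move=> [u ->]; exists (fun j => u j * g).
by rewrite mulr_suml; apply: eq_bigr => j _; rewrite mulrAC.
Qed.

Lemma in_mon_idealZ d c f : in_mon_ideal d f -> in_mon_ideal d (c *: f).
Proof. by rewrite -mul_mpolyC mulrC; apply: in_mon_ideal_mull. Qed.

Lemma in_mon_ideal_le d e f :
  (forall j, e j <= d j)%N -> in_mon_ideal d f -> in_mon_ideal e f.
Proof.
move=> e_d /in_mon_idealP f0; apply/in_mon_idealP => a /belowP a_e.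
by apply/f0/belowP=> j; apply: leq_trans (e_d j).
Qed.

(** * Injectivity when some d_j exceeds i + m *)

Lemma mcoeff_sum_varsX j m : (sum_vars k n ^+ m)@_(U_(j) *+ m) = 1.
Proof.
elim: m => [|m IHm]; first by rewrite expr0 mulm0n mcoeff1 eqxx.
rewrite exprSr mulr_sumr raddf_sum /= (bigD1 j) //= big1 ?addr0 => [|i ij].
  by rewrite mcoeff_mulX mulmnE mnm1E eqxx mul1n mulmS addmC addmK.
by rewrite mcoeff_mulX mulmnE mnm1E [j == i]eq_sym (negbTE ij).
Qed.

Lemma sum_vars_homog m : sum_vars k n ^+ m \is m.-homog.
Proof.
rewrite -{2}(mul1n m); apply: dhomogMn; apply: rpred_sum => j _.
by rewrite dhomogX /= mdeg1.
Qed.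

(* The coefficient of f l^m at a + m e_j is that of f at a, as soon as a
   has the largest exponent of x_j among the reduced monomials of f. *)
Lemma mult_map_injective_exponent d i m j :
  (i + m < d j)%N -> mult_map_injective k d i m.
Proof.
move=> im_d f f_i /in_mon_idealP fl0; apply/in_mon_idealP => a.
(* Descending induction on a_j, with r bounding d_j - a_j. *)
have [r] := ubnP (d j - a j)%N; elim: r a => // r IHr a ar a_d.
have [/eqP ai|ai] := boolP (mdeg a == i); last exact: dhomog_nemf_coeff f_i ai.
have aj_i : (a j <= i)%N by rewrite -ai mdegE (bigD1 j) //= leq_addr.
have /belowP a_dP := a_d.
pose b := (a + U_(j) *+ m)%MM.
have bE l : b l = (a l + (j == l) * m)%N by rewrite mnmDE mulmnE mnm1E.
have b_d : below d b.
  apply/belowP=> l; rewrite bE; case: eqP => [<-|_]; last first.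
    by rewrite mul0n addn0.
  by rewrite mul1n; apply: leq_ltn_trans im_d; rewrite leq_add2r.
have := fl0 b b_d; rewrite mcoeffM_sum.
have [a_f|/memN_msupp_eq0 //] := boolP (a \in msupp f).
have ab : (a <= b)%MM by apply: lem_addr.
rewrite big_mkcond (bigD1_seq a) ?msupp_uniq //= ab {1}/b addmC addmK.
rewrite mcoeff_sum_varsX mulr1 big1_seq ?addr0 // => c /andP[ca c_f].
case: ifP => // cb; have ci := dhomog_mf f_i c_f.
have c_d : below d c.
  apply/belowP=> l; exact: leq_ltn_trans (mnm_lepP cb l) (belowP _ _ b_d l).
(* Since b and a differ only at j, c_j <= a_j would give c <= a, hence c = a by equality of
   degrees. *)
suff aj_cj : (a j < c j)%N.
  by rewrite IHr ?mul0r //; move: (belowP _ _ c_d j) (a_dP j); lia.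
rewrite ltnNge; apply: contra ca => cj_aj.
have le_ca : (c <= a)%MM.
  apply/mnm_lepP=> l; have := mnm_lepP cb l; rewrite bE.
  by case: eqP => [<-|] //; rewrite mul0n addn0.
have := mdegD (a - c) c; rewrite submK // ai ci => /esym /eqP.
rewrite -[X in _ == X]add0n eqn_add2r mdeg_eq0 => /eqP ac0.
by rewrite -(submK le_ca) ac0 addmC addm0.
Qed.


(** * The lowering operator and its commutator with l *)

(* On monomials, x^a is sent to the sum of a_j (d_j - a_j) x^(a - e_j); the
   coefficient vanishes at a_j = d_j, so the ideal is preserved. *)
Definition lowering d f : {mpoly k[n]} :=
  \sum_(j < n) ((d j - 1)%N%:R *: f^`M(j) - f^`M(j)^`M(j) * 'X_j).

Lemma mcoeff_lowering d f b :
  (lowering d f)@_b =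
  \sum_(j < n) ((d j - 1)%N%:R - (b j)%:R) * (b j).+1%:R * f@_(b + U_(j)).
Proof.
rewrite raddf_sum /=; apply: eq_bigr => j _.
rewrite mcoeffB mcoeffZ mcoeff_mulX !mcoeff_deriv.
have [->|bj] := eqVneq (b j) 0%N; first by rewrite /= !subr0 mulr1.
rewrite /= submK ?lep1mP // mnmBE mnm1E eqxx -subSn ?lt0n // subSS subn0.
move: (f@_ _) => x; rewrite -[x *+ _]mulr_natl -[(_ * x) *+ b j]mulr_natl.
by rewrite -mulrA mulrBl.
Qed.

Lemma lowering_homog0 d f : f \is 0.-homog -> lowering d f = 0.
Proof.
move=> f0; apply/mpolyP=> b; rewrite mcoeff_lowering mcoeff0 big1 // => j _.
by rewrite (dhomog_nemf_coeff f0) ?mulr0 //= mdegD mdeg1 addn1.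
Qed.

Lemma lowering_homogS d i f : f \is i.+1.-homog -> lowering d f \is i.-homog.
Proof.
move=> f_i; apply/dhomogP => b /=; rewrite mcoeff_msupp mcoeff_lowering => b0.
apply/eqP; apply: contraR b0 => bi; rewrite big1 // => j _.
by rewrite (dhomog_nemf_coeff f_i) ?mulr0 //= mdegD mdeg1 addn1 eqSS.
Qed.

Lemma lowering_in_mon_ideal d f :
  in_mon_ideal d f -> in_mon_ideal d (lowering d f).
Proof.
move=> /in_mon_idealP f0; apply/in_mon_idealP => b /belowP b_d.
rewrite mcoeff_lowering big1 // => j _.
(* Only b_j = d_j - 1 makes b + e_j leave the reduced range, and there the scalar is zero. *)
have [bj|bj] := eqVneq (b j) (d j - 1)%N; first by rewrite bj subrr !mul0r.
rewrite f0 ?mulr0 //; apply/belowP=> l; rewrite mnmDE mnm1E.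
by move: (b_d l) bj; case: (j =P l) => [<-|_] /=; lia.
Qed.

Lemma mpoly_euler i f :
  f \is i.-homog -> \sum_(j < n) f^`M(j) * 'X_j = i%:R *: f.
Proof.
move=> f_i; apply/mpolyP=> b; rewrite raddf_sum /= mcoeffZ.
rewrite (eq_bigr (fun j => (b j)%:R * f@_b)) => [|j _].
  rewrite -mulr_suml -natr_sum -mdegE.
  have [-> //|bi] := eqVneq (mdeg b) i.
  by rewrite (dhomog_nemf_coeff f_i bi) !mulr0.
rewrite mcoeff_mulX; have [->|bj] := eqVneq (b j) 0%N; first by rewrite mul0r.
rewrite /= mcoeff_deriv submK ?lep1mP // mnmBE mnm1E eqxx -subSn ?lt0n //.
by rewrite subSS subn0 mulr_natl.
Qed.

Lemma mderiv_sum_vars j : (sum_vars k n)^`M(j) = 1.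
Proof.
rewrite raddf_sum /= (bigD1 j) //= big1 ?addr0 => [|i ij].
    rewrite mderivX mnm1E eqxx scale1r -{1}[U_(j)%MM]addm0.
  by rewrite addmC addmK mpolyX0.
by rewrite mderivX mnm1E (negbTE ij) scale0r.
Qed.

(** With D_j the j-th partial derivative, the product rule leaves (d_j - 1) f - 2 x_j D_j f for each
    j; Euler's identity sums the last terms to 2i f. *)
Lemma lowering_mul_sum_vars d i f : f \is i.-homog ->
  lowering d (f * sum_vars k n) = lowering d f * sum_vars k n +
    ((\sum_(j < n) (d j - 1))%N%:R - i%:R - i%:R) *: f.
Proof.
move=> f_i; rewrite !scalerBl -!(mpoly_euler f_i) natr_sum scaler_suml.
rewrite /lowering mulr_suml -!sumrB -big_split /=; apply: eq_bigr => j _.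
rewrite mderivM mderiv_sum_vars mulr1 mderivD mderivM mderiv_sum_vars mulr1.
rewrite -!mul_mpolyC.
by ring.
Qed.

(** The scalar is the sum of t - 2(i + s) for s from 0 to m, one commutator per factor l, where t
    sums the d_j - 1. *)
Lemma lowering_mul_sum_varsX d i m f : f \is i.-homog ->
  lowering d (f * sum_vars k n ^+ m.+1) =
  lowering d f * sum_vars k n ^+ m.+1 +
    (m.+1%:R * ((\sum_(j < n) (d j - 1))%N%:R - i%:R - i%:R - m%:R))
      *: (f * sum_vars k n ^+ m).
Proof.
move=> f_i; elim: m => [|m IHm].
  by rewrite expr0 mulr1 mul1r subr0 expr1 (lowering_mul_sum_vars d f_i).
rewrite exprSr mulrA.
have fl : f * sum_vars k n ^+ m.+1 \is (i + m.+1).-homog.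
  exact: dhomogM f_i (sum_vars_homog _).
rewrite (lowering_mul_sum_vars d fl) IHm -!mul_mpolyC !natrD.
set t := (_%N)%:R; rewrite !(rmorphM, rmorphB, rmorphD) /=.
rewrite !exprS !mpolyC_nat; ring.
Qed.

(** * Injectivity when i + m < p *)

Lemma mult_map_injective_char p d i m :
  p \in [pchar k] -> (i + m < p)%N -> (forall j, 0 < d j)%N ->
  (2 * i + m <= \sum_(j < n) (d j - 1))%N -> mult_map_injective k d i m.
Proof.
move=> p_char im_p; have [t tE] := ubnP (\sum_(j < n) (d j - 1))%N.
elim: t d i m tE im_p => // t IHt d i m tE im_p d_gt0.
(* Stated for arbitrary i', m' because the equality case calls it at two other pairs. *)
have strict i' m' : (i' + m' < p)%N ->
    (2 * i' + m' < \sum_(j < n) (d j - 1))%N -> mult_map_injective k d i' m'.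
  move=> im'_p im'_t f f_i fl; apply/in_mon_idealP => a /belowP a_d.
  have [/eqP ai|ai] := boolP (mdeg a == i'); last first.
    exact: dhomog_nemf_coeff f_i ai.
  (* If no such j exists, a is the socle monomial, so i' = t, against 2i' + m' < t. *)
  have [j aj|a_max] := pickP (fun j => a j < d j - 1)%N; last first.
    suff ti: (\sum_(j < n) (d j - 1) = i')%N by lia.
    rewrite -ai mdegE; apply: eq_bigr => j _.
    by have := a_d j; have := a_max j; lia.
  (* Here d_j > 1, a stays below e, and t drops by one, which turns the strict inequality into the
     weak one of the induction hypothesis. *)
  pose e l := (d l - (l == j))%N.
  have eE : (\sum_(l < n) (d l - 1) = (\sum_(l < n) (e l - 1)).+1)%N.
    rewrite (bigD1 j) //= [in RHS](bigD1 j) //= /e eqxx.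
    rewrite -addSn; congr (_ + _)%N; first by lia.
    by apply: eq_bigr => l /negbTE ->; rewrite subn0.
  have e_le l : (e l <= d l)%N by apply: leq_subr.
  have inj_e : mult_map_injective k e i' m'.
    rewrite eE !ltnS in tE im'_t; apply: IHt => // l.
    by rewrite /e; have [->|_] := eqVneq l j; rewrite ?subn0 //; lia.
  have /in_mon_idealP -> // := inj_e f f_i (in_mon_ideal_le e_le fl).
  apply/belowP=> l; rewrite /e; have [->|_] := eqVneq l j; first by lia.
  by rewrite subn0.
rewrite leq_eqVlt => /orP[/eqP im_t|]; last exact: strict.
case: m im_p im_t => [|m] im_p im_t f f_i fl; first by rewrite expr0 mulr1 in fl.
have := lowering_in_mon_ideal fl; rewrite (lowering_mul_sum_varsX d m f_i).
(* Now t = 2i + m + 1, so the last factor t - 2i - m is 1. *)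
rewrite (_ : _ * (_ - _ - _ - _) = m.+1%:R); last first.
  by rewrite -im_t mul2n -addnn -addn1 !natrD; ring.
move=> lfl; have lf_in : in_mon_ideal d (lowering d f).
  (* After multiplication by l, the second term is a multiple of f l^(m+1), already in the ideal. *)
  have : in_mon_ideal d (lowering d f * sum_vars k n ^+ m.+2).
    have /(in_mon_ideal_mull (sum_vars k n)) := lfl.
    rewrite mulrDl -mulrA -exprSr -scalerAl -mulrA -exprSr => H.
    have := in_mon_ideal_add H (in_mon_idealZ (- m.+1%:R) fl).
    by rewrite scaleNr addrK.
  case: i {lfl fl} f_i im_p im_t => [|i] f_i im_p im_t lfl.
    by rewrite lowering_homog0 //; apply: in_mon_ideal0.
  by apply: (strict i m.+2) lfl; [lia | lia | apply: lowering_homogS].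
apply: (strict i m) => //; try lia.
(* The bound by p enters here: 0 < m + 1 < p. *)
have m1_neq0 : m.+1%:R != 0 :> k.
  by rewrite -(dvdn_pcharf p_char) gtnNdvd //; lia.
rewrite -[f * _]scale1r -(mulVf m1_neq0) -scalerA; apply: in_mon_idealZ.
have H := in_mon_ideal_mull (- sum_vars k n ^+ m.+1) lf_in.
by have := in_mon_ideal_add lfl H; rewrite mulrN addrC addKr.
Qed.

End Ideal.

(** * Surjectivity by duality *)

(** The columns of [cokermx] lie in the right kernel of the matrix, and a row vector that they
    annihilate is in its row space. *)
Lemma linear_system_solvable (k : fieldType) (I J : finType)
    (M : I -> J -> k) (v : J -> k) :
  (forall c : J -> k, (forall x, \sum_y M x y * c y = 0) ->
     \sum_y v y * c y = 0) ->
  exists u : I -> k, forall y, v y = \sum_x u x * M x y.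
Proof.
move=> v_perp.
pose A := \matrix_(x < #|I|, y < #|J|) M (enum_val x) (enum_val y).
pose w := \row_(y < #|J|) v (enum_val y).
have /submxP[u wE] : (w <= A)%MS.
  rewrite submxE; apply/eqP/matrixP => z y; rewrite ord1 !mxE {z}.
  pose c z := cokermx A (enum_rank z) y.
  rewrite -[RHS](v_perp c) => [|x].
    rewrite [RHS](reindex_onto enum_val enum_rank) => [|z _]; last first.
      exact: enum_rankK.
    apply: eq_big => z; first by rewrite enum_valK eqxx.
    by move=> _; rewrite mxE /c enum_valK.
  have /matrixP/(_ (enum_rank x) y) E := mulmx_coker A.
  rewrite [LHS]mxE [RHS]mxE in E; rewrite -[RHS]E.
  rewrite (reindex_onto enum_val enum_rank) => [|z _].
    apply: eq_big => z; first by rewrite enum_valK eqxx.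
    by move=> _; rewrite mxE /c enum_valK enum_rankK.
  exact: enum_rankK.
exists (fun x => u 0 (enum_rank x)) => y.
have /matrixP/(_ 0 (enum_rank y)) := wE.
rewrite mxE [X in _ = X -> _]mxE enum_rankK => ->.
rewrite [RHS](reindex_onto enum_val enum_rank) => [|z _]; last exact: enum_rankK.
apply: eq_big => z; first by rewrite enum_valK eqxx.
by move=> _; rewrite mxE !enum_valK enum_rankK.
Qed.

Section Duality.
Variables (k : fieldType) (n : nat) (d : 'I_n -> nat).
Implicit Types (f g q : {mpoly k[n]}) (a b : 'X_{1..n}).

Let t := (\sum_(j < n) (d j - 1))%N.

(** A monomial basis of A_i; bounding the degree makes it a finite type, fit to index a matrix. *)
Definition reduced_mon i := {a : 'X_{1..n < i.+1} | below d a && (mdeg a == i)}.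

Definition mon_of i (x : reduced_mon i) : 'X_{1..n} := val (val x).

Lemma mon_of_inj i : injective (@mon_of i).
Proof. by move=> x y /val_inj/val_inj. Qed.

Lemma below_mon_of i (x : reduced_mon i) : below d (mon_of x).
Proof. by case/andP: (valP x). Qed.

Lemma mdeg_mon_of i (x : reduced_mon i) : mdeg (mon_of x) = i.
Proof. by case/andP: (valP x) => _ /eqP. Qed.

Lemma mon_of_surj i a : below d a -> mdeg a = i ->
  exists x : reduced_mon i, mon_of x = a.
Proof.
move=> a_d ai; have a_lt : (mdeg a < i.+1)%N by rewrite ai.
have aP : below d (BMultinom a_lt) && (mdeg (BMultinom a_lt) == i).
  by rewrite a_d ai eqxx.
by exists (Sub (BMultinom a_lt) aP).
Qed.

Definition mon_compl a : 'X_{1..n} := [multinom (d j - 1 - a j)%N | j < n].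

Lemma below_mon_compl a : (forall j, 0 < d j)%N -> below d (mon_compl a).
Proof. by move=> d0; apply/belowP=> j; rewrite mnmE; have := d0 j; lia. Qed.

Lemma mon_complK a : below d a -> mon_compl (mon_compl a) = a.
Proof.
by move=> /belowP a_d; apply/mnmP=> j; rewrite !mnmE; have := a_d j; lia.
Qed.

Lemma mdeg_mon_compl a : below d a -> (mdeg (mon_compl a) + mdeg a = t)%N.
Proof.
move=> /belowP a_d; rewrite !mdegE -big_split /=; apply: eq_bigr => j _.
by rewrite mnmE; have := a_d j; lia.
Qed.

(** Both sides are the coefficient of q at b - a when a <= b, and zero otherwise, because
    complementation reverses divisibility. *)
Lemma mcoeff_mon_compl q a b : below d a -> below d b ->
  (q * 'X_[mon_compl b])@_(mon_compl a) = (q * 'X_[a])@_b.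
Proof.
move=> /belowP a_d /belowP b_d; rewrite !mcoeff_mulXm.
have -> : (mon_compl b <= mon_compl a)%MM = (a <= b)%MM.
  apply/mnm_lepP/mnm_lepP=> H j; have := H j; rewrite !mnmE;
  by have := a_d j; have := b_d j; lia.
case: ifP => // /mnm_lepP ab; congr mcoeff; apply/mnmP => j.
by rewrite !mnmE; have := a_d j; have := b_d j; have := ab j; lia.
Qed.

Lemma mdeg_below_le a : below d a -> (mdeg a <= t)%N.
Proof. by move=> /mdeg_mon_compl <-; apply: leq_addl. Qed.

(* In the monomial bases, multiplication by l^m on A_i and on A_(t-i-m) are
   transpose to each other, through the complement x^a -> x^(d-1-a). *)
Lemma mult_map_surjective_dual i i' m : (forall j, 0 < d j)%N ->
  (i' + (i + m) = t)%N ->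
  mult_map_injective k d i' m -> mult_map_surjective k d i m.
Proof.
move=> d_gt0 i'E inj g g_im; pose L := sum_vars k n ^+ m.
pose M (x : reduced_mon i) (y : reduced_mon (i + m)) :=
  (L * 'X_[mon_of x])@_(mon_of y).
have [c Mc0|u uE] := @linear_system_solvable _ _ _ M (fun y => g@_(mon_of y)).
  apply: big1 => y _.
  (* A kernel vector c becomes a form h of degree i' with h l^m in the ideal; injectivity then
     forces c = 0. *)
  pose h := \sum_(z : reduced_mon (i + m)) c z *: 'X_[k, mon_compl (mon_of z)].
  suff : in_mon_ideal d h.
    move=> /in_mon_idealP/(_ (mon_compl (mon_of y))).
    rewrite raddf_sum (bigD1 y) //= mcoeffZ mcoeffX eqxx mulr1 big1 ?addr0.
      by move=> ->; rewrite ?mulr0 //; apply: below_mon_compl.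
    move=> z zy; rewrite mcoeffZ mcoeffX (_ : _ == _ = false) ?mulr0 //.
    apply: contra_neqF zy => /eqP/(congr1 mon_compl).
    by rewrite !mon_complK ?below_mon_of // => /mon_of_inj.
  have h_i' : h \is i'.-homog.
    apply: rpred_sum => z _; apply: dhomogZ; rewrite dhomogX /=.
    have := mdeg_mon_compl (below_mon_of z).
    by rewrite mdeg_mon_of -i'E => /addIn->.
  apply: inj => //; apply/in_mon_idealP => a a_d.
  have [/eqP am|am] := boolP (mdeg a == i' + m)%N; last first.
    exact: dhomog_nemf_coeff (dhomogM h_i' (sum_vars_homog _ _ _)) am.
  (* The coefficient of h l^m at a is the kernel equation of the row indexed by the complement of
     a. *)
  have [x xE] : exists x : reduced_mon i, mon_of x = mon_compl a.
    apply: mon_of_surj; first exact: below_mon_compl.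
    by have := mdeg_mon_compl a_d; rewrite am -i'E; lia.
  rewrite -(Mc0 x) mulr_suml raddf_sum /=; apply: eq_bigr => z _.
  rewrite -scalerAl mcoeffZ mulrC /M -mcoeff_mon_compl ?below_mon_of //.
  by rewrite xE mon_complK // ['X_[_] * _]mulrC.
pose f := \sum_(x : reduced_mon i) u x *: 'X_[k, mon_of x].
have f_i : f \is i.-homog.
  apply: rpred_sum => x _; apply: dhomogZ.
  by rewrite dhomogX /= mdeg_mon_of.
exists f => //; apply/in_mon_idealP => b b_d; rewrite mcoeffB.
have [/eqP bm|bm] := boolP (mdeg b == i + m)%N; last first.
  rewrite (dhomog_nemf_coeff g_im bm).
  by rewrite (dhomog_nemf_coeff (dhomogM f_i (sum_vars_homog _ _ _)) bm) subr0.
have [y <-] := mon_of_surj b_d bm.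
apply/eqP; rewrite subr_eq0 uE mulr_suml raddf_sum /=; apply/eqP.
by apply: eq_bigr => x _; rewrite -scalerAl mcoeffZ ['X_[_] * _]mulrC.
Qed.

Lemma mult_map_surjective_large i m :
  (t < i + m)%N -> mult_map_surjective k d i m.
Proof.
move=> t_im g g_im; exists 0; first exact: dhomog0.
rewrite mul0r subr0; apply/in_mon_idealP => a /mdeg_below_le a_t.
by apply: dhomog_nemf_coeff g_im _; rewrite /= neq_ltn (leq_ltn_trans a_t).
Qed.

End Duality.

Theorem theorem2p7 (k : fieldType) (p : nat) (n : nat) (d : 'I_n -> nat)
  (m : nat) :
  p \in [pchar k] ->
  (forall j, 0 < d j)%N ->
  (let t := (\sum_(j < n) (d j - 1))%N in
   t + m < 2 * maxn p (\max_(j < n) d j))%N ->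
  forall i : nat, mult_map_max_rank k d i m.
Proof.
move=> p_char d_gt0 /=; set t := (\sum_(j < n) _)%N => t_max i.
have inj i' : (2 * i' + m <= t)%N -> mult_map_injective k d i' m.
  (* Doubling gives 2(i' + m) <= t + m. *)
  move=> im_t; have: (i' + m < maxn p (\max_(j < n) d j))%N.
    by rewrite -(ltn_pmul2l (isT : 0 < 2)%N); apply: leq_ltn_trans t_max; lia.
  rewrite leq_max => /orP[im_p|].
    exact: mult_map_injective_char p_char im_p d_gt0 im_t.
  rewrite ltnNge => /bigmax_leqP d_im.
  have [j|no_j] := pickP (fun j => i' + m < d j)%N.
    exact: mult_map_injective_exponent.
  by case: d_im => j _; rewrite leqNgt no_j.
have [/inj|t_lt] := leqP (2 * i + m) t; first by left.
right; have [im_t|] := leqP (i + m) t; last exact: mult_map_surjective_large.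
apply: (@mult_map_surjective_dual _ _ _ _ (t - (i + m))) => //.
  exact: subnK.
(* With i' = t - i - m, 2i' + m = 2t - (2i + m) < t. *)
by apply: inj; lia.
Qed.
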